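(* Let $k$ be a positive integer, $d=2k-1$, and let $Z=\{P_1,\dots,P_{d+1}\}\subset\mathbb{P}^2=\mathbb{P}^2_{\mathbb{C}}$ be a set of $d+1$ points in general position. Put $m=d$ and consider the square interpolation determinant $F_{d,d;Z}(B)=\det M(d,d;Z;B)$ as a polynomial in the coordinates of the point $B$. Then the degeneracy locus is the union of all secant lines to $Z$: $$\{F_{d,d;Z}=0\}=\bigcup_{1\le i<j\le d+1}\langle P_i,P_j\rangle ,$$ where $\langle P_i,P_j\rangle$ is the line through $P_i$ and $P_j$. In particular, $F_{d,d;Z}$ splits over $\mathbb{C}$ as a product of linear forms defining these $\binom{d+1}{2}$ lines.
   Context: Let $S=\mathbb{C}[x,y,z]=\bigoplus_d S_d$. For a finite set $Z=\{P_1,\dots,P_s\}\subset\mathbb{P}^2$ of distinct points and a point $B=(a_0:a_1:a_2)\in\mathbb{P}^2$, fix a monomial basis $w$ of $S_d$. The interpolation matrix $M(d,m;Z;B)$ has $s+\binom{m+1}{2}$ rows and $\binom{d+2}{2}$ columns: the first $s$ rows are the evaluations $w(P_i)$ (for chosen coordinate vectors of the $P_i$), and the remaining $\binom{m+1}{2}$ rows are all partial derivatives of order $m-1$ of $w$ with respect to $x,y,z$, evaluated at $(a_0,a_1,a_2)$. For $s=d+1$ and $m=d$ the matrix is square, and its determinant $F_{d,d;Z}$ is a homogeneous polynomial in $(a_0,a_1,a_2)$, well defined up to a nonzero scalar. Points in general position are in particular distinct with no three collinear. *)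

(* Defs.v *)
From HB Require Import structures.
From mathcomp Require Import all_boot all_order all_algebra.
From mathcomp Require Import mpoly complex reals.
Set Implicit Arguments.
Unset Strict Implicit.
Unset Printing Implicit Defensive.
Import GRing.Theory.
Local Open Scope ring_scope.

Section Plane.
Variable K : fieldType.

(* Points of the projective plane over K are the lines through 0 in K^3. *)
Record ppoint := PPoint {
  pline :> {vspace 'rV[K]_3};
  dim_pline : \dim pline = 1%N
}.

(* v is a vector of homogeneous coordinates of P; this forces v != 0. *)
Definition coords_of (v : 'rV[K]_3) (P : ppoint) : Prop := (<[v]> = P)%VS.

Definition on_secant (P Q B : ppoint) : Prop := (B <= P + Q)%VS.

(* Lines of the plane are the two-dimensional subspaces of K^3. *)
Definition collinear (P Q B : ppoint) : Prop :=
  exists L : {vspace 'rV[K]_3},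
    [/\ \dim L = 2, (P <= L)%VS, (Q <= L)%VS & (B <= L)%VS].

Definition general_position n (Z : 'I_n -> ppoint) : Prop :=
  injective Z /\
  forall i j l : 'I_n, i != j -> i != l -> j != l ->
    ~ collinear (Z i) (Z j) (Z l).

Definition zero_locus (f : {mpoly K[3]}) (B : ppoint) : Prop :=
  forall b : 'rV[K]_3, coords_of b B -> f.@[b 0] = 0.

(* w lists every monomial of degree e in x, y, z exactly once. *)
Definition monomial_listing (e N : nat) (w : N.-tuple 'X_{1..3}) : Prop :=
  uniq w /\ forall mu : 'X_{1..3}, (mu \in w) = (mdeg mu == e).

(* M(d,m;Z;B), with B = ('X_0 : 'X_1 : 'X_2) the generic point, so that the
   entries are polynomials in the coordinates of B. The monomial basis of S_d is
   w, the differential operators of order m - 1 are listed as multi-indices in D,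
   and p i is the vector of coordinates chosen for the i-th point of Z. *)
Definition interpolation_mx (d m s : nat) (w : 'C(d.+2, 2).-tuple 'X_{1..3})
    (D : 'C(m.+1, 2).-tuple 'X_{1..3}) (p : 'I_s -> 'rV[K]_3) :
    'M[{mpoly K[3]}]_(s + 'C(m.+1, 2), 'C(d.+2, 2)) :=
  col_mx
    (\matrix_(i < s, j < 'C(d.+2, 2))
       (('X_[tnth w j] : {mpoly K[3]}).@[p i 0])%:MP)
    (\matrix_(i < 'C(m.+1, 2), j < 'C(d.+2, 2))
       ('X_[tnth w j] : {mpoly K[3]})^`M[tnth D i]).

Lemma interpolation_square d : (d.+1 + 'C(d.+1, 2) = 'C(d.+2, 2))%N.
Proof. by rewrite [RHS]binS bin1 addnC. Qed.

Definition interpolation_det (d : nat) (w : 'C(d.+2, 2).-tuple 'X_{1..3})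
    (D : 'C(d.+1, 2).-tuple 'X_{1..3}) (p : 'I_d.+1 -> 'rV[K]_3) :
    {mpoly K[3]} :=
  \det (castmx (interpolation_square d, erefl) (interpolation_mx w D p)).

End Plane.

(* Main.v *)
Require Import Defs.
From HB Require Import structures.
From mathcomp Require Import all_boot all_order all_fingroup all_algebra.
From mathcomp Require Import ring zify.
From mathcomp Require Import mpoly complex reals.
Set Implicit Arguments.
Unset Strict Implicit.
Unset Printing Implicit Defensive.
Import GRing.Theory Num.Theory.
Local Open Scope ring_scope.

(** A form of degree d with multiplicity d at B is a product of d lines through B,
    that is, a binary form of degree d on the pencil of lines at B. So F vanishes
    at B exactly when a nonzero binary form of degree d vanishes at the d+1
    projections of the points from B, that is, when two of them are aligned with
    B. This is made quantitative by computing F: up to a nonzero constant,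
      F(b) = prod_(i < j) det (p_i, p_j, b).

    Let b be the generic point, u = b_0 y - b_1 x and v = b_0 z - b_2 x, two lines
    through b. The monomials of degree d are y^(d-c) z^c for c = 0, ..., d and the
    x D_j, where the D_j are the monomials of degree d - 1, which also index the
    derivatives. Replacing y^(d-c) z^c by u^(d-c) v^c is a column operation of
    determinant b_0^(d(d+1)) ([pencil_form_expand]). The new columns vanish to
    order d at b ([pencil_form_vanishes]), so the matrix becomes block triangular
    ([det_adapted_interpolation]):
    - the block of evaluations of the u^(d-c) v^c at the points is a homogeneous
      Vandermonde matrix ([det_homogeneous_Vandermonde]) and its determinant is the
      product over i < j of
        u(p_i) v(p_j) - u(p_j) v(p_i) = b_0 det (p_i, p_j, b);
    - the block of derivatives of the x D_j is triangular
      ([det_derivative_block]), with determinant a positive integer times a power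
      of b_0.
    The powers of b_0 cancel ([interpolation_det_factor]). The form
    det (p_i, p_j, b) vanishes exactly on the line through the two points
    ([secant_form_eq0]), which gives both the zero locus and the splitting. *)

Local Notation ix := (@ord0 2).
Local Notation iy := (lift (@ord0 2) (@ord0 1)).
Local Notation iz := (lift (@ord0 2) (lift (@ord0 1) (@ord0 0))).

(** * Products over pairs and determinants *)

(** Each index lies in exactly n pairs. *)
Lemma prod_lt_pairs (A : comNzRingType) n (F : 'I_n.+1 -> A) :
  \prod_(i < n.+1) \prod_(j < n.+1 | (i < j)%N) (F i * F j) =
  \prod_(i < n.+1) F i ^+ n.
Proof.
under eq_bigr do rewrite big_split /=.
rewrite big_split /= [X in _ * X](exchange_big_dep xpredT) //= -big_split /=.
apply: eq_bigr => i _.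
transitivity (\prod_(j < n.+1 | j != i) F i).
  rewrite [RHS](bigID (fun j : 'I_n.+1 => (i < j)%N)) /=.
  by congr (_ * _); apply: eq_bigl => j; rewrite -(inj_eq val_inj) /=;
    case: ltngtP.
by rewrite prodr_const cardC1 card_ord.
Qed.

Lemma prod_lt_const (A : comNzRingType) n (a : A) :
  \prod_(i < n) \prod_(j < n | (i < j)%N) a = a ^+ 'C(n, 2).
Proof.
rewrite (exchange_big_dep xpredT) //= -bin2_sum big_mkord -prodrXr.
apply: eq_bigr => j _; rewrite prodr_const; congr (_ ^+ _).
transitivity #|[set i : 'I_n | (i < j)%N]|; first by rewrite cardsE.
rewrite -sum1dep_card -(big_ord_widen n (fun _ => 1%N)) 1?ltnW //.
by rewrite sum1_card card_ord.
Qed.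

(** A permutation whose term in the Leibniz formula survives never increases
    the rank and decreases it at every point that it moves; as it preserves the
    sum of all ranks, it moves nothing. Only a rank is asked for, so no ordering
    of the indices has to be chosen. *)
Lemma det_triangular_rank (A : comNzRingType) n (r : 'I_n -> nat)
    (M : 'M[A]_n) :
  (forall i j, M i j != 0 -> i = j \/ (r j < r i)%N) ->
  \det M = \prod_(i < n) M i i.
Proof.
move=> Mtri; rewrite /determinant (bigD1 (1%g : 'S_n)) //= odd_perm1 expr0 mul1r.
under eq_bigr do rewrite perm1.
rewrite [X in _ + X]big1 ?addr0 // => s s_neq1.
have [i Mi0|Mn0] := pickP (fun i => M i (s i) == 0).
  by rewrite (bigD1 i) //= (eqP Mi0) mul0r mulr0.
have le_r i : (r (s i) <= r i)%N.
  by case: (Mtri i (s i)) => [|<-|/ltnW]; rewrite ?Mn0.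
have sum_r : (\sum_i r (s i) = \sum_i r i)%N.
  by rewrite [RHS](reindex_inj (@perm_inj _ s)).
case/eqP: s_neq1; apply/permP => i; rewrite perm1.
have [//|lt_r] := Mtri i (s i) (negbT (Mn0 i)).
suff : (\sum_i r (s i) < \sum_i r i)%N by rewrite sum_r ltnn.
rewrite (bigD1 i) //= [X in (_ < X)%N](bigD1 i) //= -addSn.
by rewrite leq_add // leq_sum.
Qed.

(** Dividing row i by [u i ^+ n] gives the Vandermonde matrix of the ratios
    [v i / u i]. *)
Lemma det_homogeneous_Vandermonde_field (F : fieldType) n
    (u v : 'I_n.+1 -> F) :
  (forall i, u i != 0) ->
  \det (\matrix_(i, c < n.+1) (u i ^+ (n - c) * v i ^+ c)) =
  \prod_(i < n.+1) \prod_(j < n.+1 | (i < j)%N) (u i * v j - u j * v i).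
Proof.
move=> u0.
have -> : \matrix_(i, c < n.+1) (u i ^+ (n - c) * v i ^+ c) =
    diag_mx (\row_i u i ^+ n) *m (Vandermonde n.+1 (\row_i (v i / u i)))^T.
  apply/matrixP => i c; rewrite mul_diag_mx !mxE expr_div_n mulrCA.
  by rewrite mulrC expfB_cond ?(negPf (u0 i)) ?add0n ?leq_ord //; ring.
rewrite det_mulmx det_diag det_tr det_Vandermonde.
under eq_bigr do rewrite mxE.
rewrite -prod_lt_pairs -big_split; apply: eq_bigr => i _ /=.
rewrite -big_split; apply: eq_bigr => j _ /=.
by rewrite !mxE; field; rewrite !u0.
Qed.

(** To allow for zeros among the [u i], the identity is proved for ['X + u i] in
    the fraction field of {poly A}, and then specialized at 0. *)
Lemma det_homogeneous_Vandermonde (A : idomainType) n (u v : 'I_n.+1 -> A) :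
  \det (\matrix_(i, c < n.+1) (u i ^+ (n - c) * v i ^+ c)) =
  \prod_(i < n.+1) \prod_(j < n.+1 | (i < j)%N) (u i * v j - u j * v i).
Proof.
pose U i : {poly A} := 'X + (u i)%:P; pose V i : {poly A} := (v i)%:P.
have U0 i : tofrac (U i) != 0.
  by rewrite tofrac_eq0 -size_poly_eq0 /U size_XaddC.
have VdM : \det (\matrix_(i, c < n.+1) (U i ^+ (n - c) * V i ^+ c)) =
    \prod_(i < n.+1) \prod_(j < n.+1 | (i < j)%N) (U i * V j - U j * V i).
  apply/eqP; rewrite -tofrac_eq -det_map_mx rmorph_prod; apply/eqP.
  transitivity (\det (\matrix_(i, c < n.+1)
      (tofrac (U i) ^+ (n - c) * tofrac (V i) ^+ c))).
    by congr (\det _); apply/matrixP => i c; rewrite !mxE rmorphM !rmorphXn.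
  rewrite det_homogeneous_Vandermonde_field //; apply: eq_bigr => i _.
  by rewrite rmorph_prod; apply: eq_bigr => j _; rewrite rmorphB !rmorphM.
have hU i : (U i).[0] = u i by rewrite /U !hornerE.
have hV i : (V i).[0] = v i by rewrite /V hornerC.
have := congr1 (horner_eval 0) VdM; rewrite -det_map_mx rmorph_prod.
move=> VdM0; transitivity (\det (map_mx (horner_eval 0)
    (\matrix_(i, c < n.+1) (U i ^+ (n - c) * V i ^+ c)))).
  congr (\det _); apply/matrixP => i c.
  by rewrite !mxE rmorphM !rmorphXn /= /horner_eval hU hV.
rewrite VdM0; apply: eq_bigr => i _.
rewrite rmorph_prod; apply: eq_bigr => j _.
by rewrite rmorphB !rmorphM /= /horner_eval !hU !hV.
Qed.

(** * Forms of degree n with a point of multiplicity n *)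

(** The determinant of the 3 x 3 matrix with rows p, q, b. *)
Definition triple (A : nzRingType) (p q b : 'I_3 -> A) : A :=
  b ix * (p iy * q iz - p iz * q iy) + b iy * (p iz * q ix - p ix * q iz)
  + b iz * (p ix * q iy - p iy * q ix).

Section Pencil.
Variables (A : comNzRingType) (b : 'I_3 -> A).

Definition vanishes_to_order n (f : {mpoly A[3]}) :=
  forall nu : 'X_{1..3}, (mdeg nu < n)%N -> f^`M[nu].@[b] = 0.

(** By the Leibniz rule, a derivative of [g * f] is a multiple of [f] plus [g]
    times a derivative of [f], which vanishes to one order less. *)
Lemma vanishes_to_orderS n f g :
  (forall k, exists c, g^`M(k) = c%:MP) -> g.@[b] = 0 ->
  vanishes_to_order n f -> vanishes_to_order n.+1 (g * f).
Proof.
move=> g_lin gb; elim: n f => [|n IHn] f fb nu ltnu.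
  have /eqP -> : nu == 0%MM by rewrite -mdeg_eq0 -leqn0.
  by rewrite mderivm0m mevalM gb mul0r.
have [->|nu0] := eqVneq nu 0%MM.
  by rewrite mderivm0m mevalM gb mul0r.
have [k nuk] : exists k, (0 < nu k)%N.
  apply/existsP; apply: contraLR nu0; rewrite negb_exists negbK => /forallP nu0.
  by apply/eqP/mnmP => k; rewrite mnm0E; apply/eqP; rewrite -leqn0 leqNgt.
have le_k : (U_(k) <= nu)%MM by rewrite lep1mP -lt0n.
have dnu : nu = (U_(k) + (nu - U_(k)))%MM by rewrite addmC submK.
have ltk : (mdeg (nu - U_(k)) < n.+1)%N.
  by move: ltnu; rewrite {1}dnu mdegD mdeg1.
rewrite {1}dnu mderivmDm mderivmU1m mderivM.
have [c ->] := g_lin k.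
rewrite mderivmD mevalD mderivm_mulC mevalM fb // mulr0 add0r IHn //.
move=> mu ltmu; rewrite -mderivmU1m -mderivmDm fb //.
by rewrite mdegD mdeg1.
Qed.

(** For k = y, z these are two lines that meet in b alone when the first
    coordinate of b is nonzero. *)
Definition line_through k : {mpoly A[3]} := b ix *: 'X_k - b k *: 'X_ix.

Definition pencil_form n c : {mpoly A[3]} :=
  line_through iy ^+ (n - c) * line_through iz ^+ c.

Lemma vanishes_line_mul k n f :
  vanishes_to_order n f -> vanishes_to_order n.+1 (line_through k * f).
Proof.
apply: vanishes_to_orderS => [l|].
  exists (b ix * (k == l)%:R - b k * (ix == l)%:R).
  rewrite /line_through mderivB !mderivZ !mderivX !mnm1E.
  have X1 (i : 'I_3) : ((i == l)%:R : A) *: 'X_[U_(i) - U_(l)] =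
      ((i == l)%:R)%:MP :> {mpoly A[3]}.
    case: eqP => [->|_]; last by rewrite scale0r mpolyC0.
    by rewrite -{1}[U_(l)%MM]add0m addmK mpolyX0 scale1r mpolyC1.
  by rewrite !X1 mpolyCB !mpolyCM !mul_mpolyC.
by rewrite mevalB !mevalZ !mevalXU; ring.
Qed.

Lemma pencil_form_vanishes n c : (c <= n)%N ->
  vanishes_to_order n (pencil_form n c).
Proof.
move=> le_cn; rewrite /pencil_form -{1}(subnK le_cn).
elim: (n - c)%N => [|i IHi]; last first.
  by rewrite exprS -mulrA; apply: vanishes_line_mul.
rewrite expr0 mul1r add0n; elim: c {le_cn} => [|c IHc] //.
by rewrite exprS; apply: vanishes_line_mul.
Qed.

(** Congruence of f with a monomial modulo x, with the degree of the cofactor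
    recorded. The last clause makes up for [0.-1 = 0]: for constants there is no
    room for a multiple of x. *)
Definition mod_x_monomial n (a : A) mu (f : {mpoly A[3]}) :=
  exists g, [/\ f = a *: 'X_[mu] + 'X_ix * g, g \is n.-1.-homog
              & n = 0%N -> g = 0].

Lemma mod_x_monomialS k n a mu f : mdeg mu = n ->
  mod_x_monomial n a mu f ->
  mod_x_monomial n.+1 (b ix * a) (U_(k) + mu) (line_through k * f).
Proof.
move=> dmu [g [-> gh g0]].
exists (b ix *: ('X_k * g) - (b k * a) *: 'X_[mu] - b k *: ('X_ix * g)).
split=> //.
  rewrite /line_through mpolyXD -!mul_mpolyC !mpolyCM; ring.
have Xg l : 'X_l * g \is n.-homog.
  case: n dmu gh g0 => [|n] _ gh g0; first by rewrite g0 // mulr0 dhomog0.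
  by rewrite -[n.+1]add1n; apply: dhomogM => //; rewrite dhomogX /= mdeg1.
by rewrite !rpredB ?dhomogZ ?dhomogX //= dmu.
Qed.

Lemma pencil_form_mod_x n c : (c <= n)%N ->
  mod_x_monomial n (b ix ^+ n) (U_(iy) *+ (n - c) + U_(iz) *+ c)
    (pencil_form n c).
Proof.
move=> le_cn; rewrite /pencil_form -{1 2}(subnK le_cn).
elim: (n - c)%N => [|i IHi].
  rewrite expr0 mul1r add0n mulm0n add0m; elim: c {le_cn} => [|c IHc].
    exists 0; rewrite mulm0n mpolyX0 expr0 scale1r mulr0 addr0 dhomog0.
    by split.
  rewrite !exprS mulmS; apply: mod_x_monomialS => //.
  by rewrite mdegMn mdeg1 mul1n.
rewrite addSn !exprS -mulrA mulmS -addmA; apply: mod_x_monomialS => //.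
by rewrite mdegD !mdegMn !mdeg1 !mul1n.
Qed.

Lemma homog_monomial_sum n N (w : N.-tuple 'X_{1..3}) (f : {mpoly A[3]}) :
  monomial_listing n w -> f \is n.-homog ->
  f = \sum_(j < N) f@_(tnth w j) *: 'X_[tnth w j].
Proof.
move=> [uw wE] fh.
rewrite -(big_tuple _ _ w predT (fun mu => f@_mu *: 'X_[mu])).
apply/mpolyP => mu; rewrite raddf_sum /=.
have [/eqP dmu|ndmu] := boolP (mdeg mu == n).
  rewrite (bigD1_seq mu) //= ?wE ?dmu // mcoeffZ mcoeffX eqxx mulr1.
  rewrite big1 ?addr0 // => nu nu_mu.
  by rewrite mcoeffZ mcoeffX (negPf nu_mu) mulr0.
rewrite (dhomog_nemf_coeff fh ndmu) big1_seq // => nu /= nu_w.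
rewrite mcoeffZ mcoeffX; case: eqP => [e|]; last by rewrite mulr0.
by move: nu_w; rewrite e wE (negPf ndmu).
Qed.

(** Up to multiples of x, y^(n-c) z^c can be replaced by a form with multiplicity
    n at b. In matrix terms, the pencil forms are obtained from the monomials by
    a column operation that is block triangular with scalar diagonal blocks. *)
Lemma pencil_form_expand n m (D : m.-tuple 'X_{1..3}) :
  (0 < n)%N -> monomial_listing n.-1 D ->
  exists t : 'M[A]_(m, n.+1), forall c : 'I_n.+1,
    pencil_form n c = b ix ^+ n *: 'X_[U_(iy) *+ (n - c) + U_(iz) *+ c]
      + \sum_(j < m) t j c *: 'X_[U_(ix) + tnth D j].
Proof.
move=> n_gt0 hD.
have /fin_all_exists [g hg] (c : 'I_n.+1) : exists g,
    pencil_form n c = b ix ^+ n *: 'X_[U_(iy) *+ (n - c) + U_(iz) *+ c]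
      + 'X_ix * g /\ g \is n.-1.-homog.
  have [|g [-> gh _]] := @pencil_form_mod_x n c; first exact: leq_ord.
  by exists g.
exists (\matrix_(j, c) (g c)@_(tnth D j)) => c.
have [-> /(homog_monomial_sum hD) {1}->] := hg c.
rewrite mulr_sumr; congr (_ + _); apply: eq_bigr => j _.
by rewrite mxE mpolyXD scalerAr.
Qed.

End Pencil.

(** * The interpolation matrix in block form *)

Section InterpolationBlocks.
Variables (n m : nat) (D : m.-tuple 'X_{1..3}).
Hypotheses (n_gt0 : (0 < n)%N) (D_orders : monomial_listing n.-1 D).

Definition free_monomial (c : 'I_n.+1) : 'X_{1..3} :=
  (U_(iy) *+ (n - c) + U_(iz) *+ c)%MM.
Definition x_monomial (j : 'I_m) : 'X_{1..3} := (U_(ix) + tnth D j)%MM.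

(** The monomials free of x first, then x times the monomials of degree n - 1 in
    the order in which the differential operators are listed. *)
Definition adapted_monomial (l : 'I_(n.+1 + m)) : 'X_{1..3} :=
  match split l with inl c => free_monomial c | inr j => x_monomial j end.

Lemma adapted_monomial_inj : injective adapted_monomial.
Proof.
have [uD DE] := D_orders.
have free0 c : free_monomial c ix = 0%N.
  by rewrite /free_monomial mnmDE !mulmnE !mnm1E.
have x0 j : x_monomial j ix = (tnth D j ix).+1.
  by rewrite /x_monomial mnmDE mnm1E eqxx.
move=> k l; rewrite -(splitK k) -(splitK l) /adapted_monomial !unsplitK.
case: (split k) (split l) => [c|j] [c'|j'] e.
- congr (unsplit (inl _)); apply/val_inj.
  by have := congr1 (fun mu : 'X_{1..3} => mu iz) e;
    rewrite /free_monomial !mnmDE !mulmnE !mnm1E /= !mul0n !mul1n.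
- by have := free0 c; rewrite e x0.
- by have := free0 c'; rewrite -e x0.
- congr (unsplit (inr _)); apply: (tuple_uniqP _ uD); apply/eqP.
  by move/eqP: e; rewrite /x_monomial eqm_add2l.
Qed.

Lemma mdeg_adapted_monomial l : mdeg (adapted_monomial l) = n.
Proof.
rewrite /adapted_monomial; case: split => [c|j].
  by rewrite mdegD !mdegMn !mdeg1 !mul1n subnK ?leq_ord.
have /eqP dj : mdeg (tnth D j) == n.-1 by rewrite -D_orders.2 mem_tnth.
by rewrite mdegD mdeg1 dj add1n prednK.
Qed.

Section Evaluation.
Variables (A : idomainType) (p : 'I_n.+1 -> 'I_3 -> A) (b : 'I_3 -> A).

(** The interpolation matrix over any domain. Taking for b the generic point, with
    coordinates in a polynomial ring, costs nothing more than a point over a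
    field, and turns the evaluation into an identity of polynomials. *)
Definition interpolation_rows N (w : 'I_N -> 'X_{1..3}) :
    'M[A]_(n.+1 + m, N) :=
  col_mx (\matrix_(i, j) ('X_[w j] : {mpoly A[3]}).@[p i])
         (\matrix_(i, j) ('X_[w j] : {mpoly A[3]})^`M[tnth D i].@[b]).

(** The operator listed as i kills x times the monomial listed as j, unless i = j
    or the operator i contains x more often than j: it has to divide a monomial
    of degree only one higher. Each diagonal entry is a multiple of x, evaluated
    at b. *)
Lemma det_derivative_block :
  \det (\matrix_(i, j < m)
     ('X_[x_monomial j] : {mpoly A[3]})^`M[tnth D i].@[b]) =
  (\prod_(j < m) \prod_(k < 3) (x_monomial j k) ^_ (tnth D j k))%:R
  * b ix ^+ m.
Proof.
have [uD DE] := D_orders.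
rewrite (@det_triangular_rank _ _ (fun j => tnth D j ix)) => [|i j].
  rewrite natr_prod -[X in b ix ^+ X]card_ord -prodr_const -big_split /=.
  apply: eq_bigr => j _.
  rewrite mxE mderivmX mevalZ; congr (_ * _).
  by rewrite /x_monomial addmK mevalXU.
rewrite mxE mderivmX mevalZ => nz.
have {nz} le_ij k : (tnth D i k <= x_monomial j k)%N.
  rewrite leqNgt; apply: contra nz => lt_k.
  by rewrite (bigD1 k) //= ffact_small // mul0n mul0r.
have [le0|] := leqP (tnth D i ix) (tnth D j ix); [left|by right].
have dE l : mdeg (tnth D l) = n.-1 by apply/eqP; rewrite -DE mem_tnth.
have /mnm_lepP le_m : forall k, (tnth D i k <= tnth D j k)%N.
  move=> k; case: (eqVneq k ix) => [->//|k0].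
  by have := le_ij k; rewrite /x_monomial mnmDE mnm1E eq_sym (negPf k0).
apply: (tuple_uniqP _ uD); rewrite -[RHS](submK le_m).
suff /eqP -> : (tnth D j - tnth D i)%MM == 0%MM by rewrite add0m.
rewrite -mdeg_eq0; have := congr1 (@mdeg 3) (submK le_m).
by rewrite mdegD !dE => /(canRL (addnK _)) ->; rewrite subnn.
Qed.

Lemma pencil_Vandermonde :
  \det (\matrix_(i, c < n.+1) (pencil_form b n c).@[p i]) =
  \prod_(i < n.+1) \prod_(j < n.+1 | (i < j)%N)
     (b ix * triple (p i) (p j) b).
Proof.
pose u k i := (line_through b k).@[p i].
transitivity (\det (\matrix_(i, c < n.+1) (u iy i ^+ (n - c) * u iz i ^+ c))).
  by congr (\det _); apply/matrixP => i c; rewrite !mxE mevalM !rmorphXn.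
rewrite det_homogeneous_Vandermonde; apply: eq_bigr => i _.
apply: eq_bigr => j _.
by rewrite /u /triple !mevalB !mevalZ !mevalXU; ring.
Qed.

(** After the column operation of [pencil_form_expand], the operators of order
    n - 1 kill the first n + 1 columns, since these forms vanish to order n at b.
    What remains on the diagonal is a Vandermonde block and a triangular block. *)
Lemma det_adapted_interpolation :
  \det (interpolation_rows adapted_monomial) * b ix ^+ (n * n.+1) =
  (\prod_(j < m) \prod_(k < 3) (x_monomial j k) ^_ (tnth D j k))%:R
  * b ix ^+ m
  * \prod_(i < n.+1) \prod_(j < n.+1 | (i < j)%N)
     (b ix * triple (p i) (p j) b).
Proof.
have [t tE] := pencil_form_expand b n_gt0 D_orders.
pose P := \matrix_(i, c < n.+1) ('X_[free_monomial c] : {mpoly A[3]}).@[p i].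
pose Y := \matrix_(i < n.+1, j < m) ('X_[x_monomial j] : {mpoly A[3]}).@[p i].
pose Q := \matrix_(i < m, c < n.+1)
  ('X_[free_monomial c] : {mpoly A[3]})^`M[tnth D i].@[b].
pose W := \matrix_(i, j < m)
  ('X_[x_monomial j] : {mpoly A[3]})^`M[tnth D i].@[b].
have -> : interpolation_rows adapted_monomial = block_mx P Y Q W.
  apply/matrixP => i j; rewrite -(splitK i) -(splitK j).
  case: (split i) (split j) => [i'|i'] [j'|j'] /=;
  rewrite ?(block_mxEul, block_mxEur, block_mxEdl, block_mxEdr);
  rewrite ?(col_mxEu, col_mxEd) !mxE;
  by rewrite /adapted_monomial ?(unsplitK (inl _)) ?(unsplitK (inr _)).
pose T := block_mx (b ix ^+ n)%:M 0 t (1%:M : 'M_m).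
have -> : b ix ^+ (n * n.+1) = \det T.
  by rewrite det_lblock det_scalar det1 mulr1 exprM.
rewrite -det_mulmx mulmx_block !mulmx0 !mulmx1 !add0r.
have -> : P *m (b ix ^+ n)%:M + Y *m t =
    \matrix_(i, c < n.+1) (pencil_form b n c).@[p i].
  apply/matrixP => i c; rewrite mul_mx_scalar !mxE tE mevalD mevalZ.
  congr (_ + _); rewrite raddf_sum; apply: eq_bigr => j _ /=.
  by rewrite !mxE mevalZ mulrC.
have -> : Q *m (b ix ^+ n)%:M + W *m t = 0.
  apply/matrixP => i c; rewrite mul_mx_scalar !mxE.
  have di : (mdeg (tnth D i) < n)%N.
    have /eqP -> : mdeg (tnth D i) == n.-1 by rewrite -D_orders.2 mem_tnth.
    by rewrite ltn_predL.
  rewrite -[RHS](pencil_form_vanishes b (leq_ord c) di) tE mderivmD mevalD.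
  rewrite mderivmZ mevalZ; congr (_ + _); rewrite !raddf_sum /=.
  by apply: eq_bigr => j _; rewrite !mxE mderivmZ mevalZ mulrC.
by rewrite det_ublock pencil_Vandermonde det_derivative_block mulrC.
Qed.

(** Listings of the monomials differ by a permutation of the columns. *)
Lemma det_interpolation_relist (w : (n.+1 + m).-tuple 'X_{1..3}) :
  monomial_listing n w ->
  exists s : bool, \det (interpolation_rows (tnth w)) =
    (-1) ^+ s * \det (interpolation_rows adapted_monomial).
Proof.
move=> [uw wE].
have /fin_all_exists [f fE] l : exists k, adapted_monomial l = tnth w k.
  by apply/tnthP; rewrite wE mdeg_adapted_monomial.
have f_inj : injective f.
  by move=> k l e; apply: adapted_monomial_inj; rewrite !fE e.
exists (odd_perm (perm f_inj)).
have -> : interpolation_rows adapted_monomial =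
    col_perm (perm f_inj) (interpolation_rows (tnth w)).
  apply/matrixP => i j; rewrite [RHS]mxE permE -(splitK i).
  by case: (split i) => i' /=; rewrite ?(col_mxEu, col_mxEd) !mxE fE.
rewrite col_permE det_mulmx det_perm odd_permV mulrCA.
by rewrite -signr_addb addbb mulr1.
Qed.

End Evaluation.
End InterpolationBlocks.

(** * Secant lines *)

Section Secants.
Variable K : fieldType.
Implicit Types (p q b : 'rV[K]_3) (P Q B : ppoint K).

Definition secant_form p q : {mpoly K[3]} :=
  triple (fun k => (p 0 k)%:MP) (fun k => (q 0 k)%:MP) (fun k => 'X_k).

Lemma secant_form_homog p q : secant_form p q \is 1.-homog.
Proof.
have hX k (f : K) : 'X_k * f%:MP \is [in K[3], 1.-homog].
  by rewrite mulrC mul_mpolyC dhomogZ // dhomogX /= mdeg1.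
by rewrite /secant_form /triple -!mpolyCM -!mpolyCB !rpredD.
Qed.

Lemma meval_secant_form p q (b : 'I_3 -> K) :
  (secant_form p q).@[b] = triple (p 0) (q 0) b.
Proof.
by rewrite /secant_form /triple !(mevalD, mevalN, mevalM, mevalC, mevalXU).
Qed.

Lemma coords_of_exists B : exists b, coords_of b B.
Proof.
have dimB := dim_pline B; exists (vpick B); apply/eqP.
by rewrite eqEdim -memvE memv_pick dimB dim_vline vpick0 -dimv_eq0 dimB.
Qed.

Lemma ppoint_inj P Q : pline P = pline Q -> P = Q.
Proof.
case: P Q => [P hP] [Q hQ] /= e; rewrite -{}e in hQ *.
by congr PPoint; apply: eq_irrelevance.
Qed.

Lemma ord3P (k : 'I_3) : [\/ k = ix, k = iy | k = iz].
Proof.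
by case: k => -[|[|[|//]]] lt_k;
  [apply: Or31 | apply: Or32 | apply: Or33]; apply: val_inj.
Qed.

(** Coordinate by coordinate the difference of the two sides is 0 or, when k, l and
    the coordinate are distinct, the triple product up to sign. *)
Lemma triple0_Cramer p q b (k l : 'I_3) :
  triple (p 0) (q 0) (b 0) = 0 ->
  (p 0 k * q 0 l - p 0 l * q 0 k) *: b =
    (b 0 k * q 0 l - b 0 l * q 0 k) *: p +
    (p 0 k * b 0 l - p 0 l * b 0 k) *: q.
Proof.
move=> dep; have depN := congr1 -%R dep; rewrite oppr0 in depN.
apply/rowP => m; rewrite !mxE; apply/eqP; rewrite -subr_eq0; apply/eqP.
by case: (ord3P k) => ->; case: (ord3P l) => ->; case: (ord3P m) => ->;
  first [ring | apply: (etrans _ dep); rewrite /triple; ring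
              | apply: (etrans _ depN); rewrite /triple; ring].
Qed.

(** If some 2 x 2 minor of (p, q) is nonzero, the previous identity expresses b
    through p and q; if all are zero, p and q are proportional. *)
Lemma secant_form_eq0 P Q B p q b :
  P <> Q -> coords_of p P -> coords_of q Q -> coords_of b B ->
  (secant_form p q).@[b 0] = 0 <-> on_secant P Q B.
Proof.
move=> PQ pP qQ bB; rewrite meval_secant_form /on_secant -bB -pP -qQ -memvE.
split; last first.
  case/memv_addP => _ /vlineP[s ->] [_ /vlineP[t ->] ->].
  by rewrite /triple !mxE; ring.
move=> dep.
have [kl kl_neq0|minor0] :=
  pickP (fun kl : 'I_3 * 'I_3 => p 0 kl.1 * q 0 kl.2 - p 0 kl.2 * q 0 kl.1 != 0).
  rewrite -[b](scalerK kl_neq0) (triple0_Cramer kl.1 kl.2 dep) memvZ //.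
  by rewrite memv_add // memvZ // memv_line.
have dim_line (v : 'rV[K]_3) V : coords_of v V -> v != 0.
  by move=> vV; have := dim_pline V; rewrite -vV dim_vline; case: (v != 0).
have /rV0Pn[l pl0] := dim_line _ _ pP.
case: PQ; apply: ppoint_inj; rewrite -pP -qQ; apply/esym/eqP.
rewrite eqEdim !dim_vline (dim_line _ _ pP) (dim_line _ _ qQ) leqnn andbT.
rewrite -memvE; apply/vlineP; exists (q 0 l / p 0 l); apply/rowP => k.
rewrite mxE mulrAC; apply: (canRL (mulfK pl0)).
have /negbFE := minor0 (k, l); rewrite /= subr_eq0 => /eqP e.
by rewrite mulrC -e mulrC.
Qed.
End Secants.

(** * Factorization of the interpolation determinant *)

Section Factor.
Variables (K : numFieldType) (d : nat).
Variables (w : 'C(d.+2, 2).-tuple 'X_{1..3}) (D : 'C(d.+1, 2).-tuple 'X_{1..3}).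
Variable (p : 'I_d.+1 -> 'rV[K]_3).

(** Both sides of [det_adapted_interpolation] carry the same power of the first
    coordinate of the generic point, as 2 C(d+1, 2) = d (d+1); it cancels. The
    constant is, up to sign, a product of falling factorials, so characteristic 0
    makes it nonzero. *)
Lemma interpolation_det_factor :
  (0 < d)%N -> monomial_listing d w -> monomial_listing d.-1 D ->
  exists2 c : K, c != 0 & interpolation_det w D p =
    c%:MP * \prod_(i < d.+1) \prod_(j < d.+1 | (i < j)%N)
              secant_form (p i) (p j).
Proof.
move=> d_gt0 w_basis D_orders.
pose A : idomainType := {mpoly K[3]}.
pose P i k : A := (p i 0 k)%:MP.
pose X k : A := 'X_k.
have X0 : X ix != 0.
  apply/eqP => /(congr1 (mcoeff U_(ix))); rewrite mcoeffX eqxx mcoeff0.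
  by move/eqP; rewrite oner_eq0.
pose c0 := (\prod_(j < 'C(d.+1, 2)) \prod_(k < 3)
  (x_monomial D j k) ^_ (tnth D j k))%N.
have c0_gt0 : (0 < c0)%N.
  apply: prodn_gt0 => j; apply: prodn_gt0 => k.
  by rewrite ffact_gt0 /x_monomial mnmDE leq_addl.
have [s sE] : exists s : bool, interpolation_det w D p =
    (-1) ^+ s * \det (interpolation_rows D P X (adapted_monomial D)).
  rewrite /interpolation_det.
  have -> : interpolation_mx w D p = interpolation_rows D P X (tnth w).
    congr col_mx; apply/matrixP => i j; rewrite !mxE.
      by rewrite !mevalX rmorph_prod; apply: eq_bigr => k _; rewrite rmorphXn.
    rewrite !mderivmX mevalZ -mpolyC_nat mul_mpolyC; congr (_ *: _).
    by rewrite mevalX mpolyXE_id.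
  move: (interpolation_square d) w w_basis; case: _ / => w' hw'.
  by rewrite castmx_id; apply: det_interpolation_relist.
exists ((-1) ^+ s * c0%:R).
  by rewrite mulf_neq0 ?signr_eq0 // pnatr_eq0 -lt0n.
apply: (mulIf (expf_neq0 (d * d.+1) X0)).
have split_X0 : \prod_(i < d.+1) \prod_(j < d.+1 | (i < j)%N)
      (X ix * triple (P i) (P j) X) =
    X ix ^+ 'C(d.+1, 2) *
      \prod_(i < d.+1) \prod_(j < d.+1 | (i < j)%N) secant_form (p i) (p j).
  rewrite -prod_lt_const -big_split; apply: eq_bigr => i _ /=.
  by rewrite big_split.
rewrite sE -mulrA (det_adapted_interpolation d_gt0 D_orders) split_X0 -/c0.
rewrite mpolyCM mpolyC_nat rmorphXn rmorphN1.
have -> : (d * d.+1 = 'C(d.+1, 2) + 'C(d.+1, 2))%N.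
  by rewrite addnn -muln2 (bin_ffact d.+1 2) !ffactnS ffactn0 muln1 mulnC.
rewrite exprD; ring.
Qed.
End Factor.

Theorem proposition4p3 (R : realType) (k d : nat) (k_gt0 : (0 < k)%N)
    (d_def : d = (2 * k - 1)%N)
    (Z : 'I_d.+1 -> ppoint R[i]) (Z_gen : general_position Z)
    (p : 'I_d.+1 -> 'rV[R[i]]_3) (p_Z : forall i, coords_of (p i) (Z i))
    (w : 'C(d.+2, 2).-tuple 'X_{1..3}) (w_basis : monomial_listing d w)
    (D : 'C(d.+1, 2).-tuple 'X_{1..3}) (D_orders : monomial_listing d.-1 D) :
  let F := interpolation_det w D p in
  (forall B : ppoint R[i],
     zero_locus F B <->
     exists i j : 'I_d.+1, (i < j)%N /\ on_secant (Z i) (Z j) B) /\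
  (exists L : 'I_d.+1 -> 'I_d.+1 -> {mpoly R[i][3]},
     (forall i j : 'I_d.+1, (i < j)%N ->
        L i j \is 1.-homog /\
        forall B : ppoint R[i],
          zero_locus (L i j) B <-> on_secant (Z i) (Z j) B) /\
     F = \prod_(i < d.+1) \prod_(j < d.+1 | (i < j)%N) L i j).
Proof.
move=> F.
have d_gt0 : (0 < d)%N by lia.
have [c c0 FE] := interpolation_det_factor p d_gt0 w_basis D_orders.
have secE (i j : 'I_d.+1) B b : (i < j)%N -> coords_of b B ->
    (secant_form (p i) (p j)).@[b 0] = 0 <-> on_secant (Z i) (Z j) B.
  move=> lt_ij; apply: secant_form_eq0 => // /Z_gen.1 e.
  by rewrite e ltnn in lt_ij.
split=> [B|].
  have [b bB] := coords_of_exists B; split=> [FB|[i [j [lt_ij Bij]]] b' b'B].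
    move/eqP: (FB b bB); rewrite -/F /F FE mevalM mevalC mulf_eq0 (negPf c0) /=.
    rewrite rmorph_prod => /prodf_eq0[i _]; rewrite rmorph_prod.
    by case/prodf_eq0 => j lt_ij /eqP /(secE _ _ _ _ lt_ij bB) Bij; exists i, j.
  apply/eqP; rewrite /F FE mevalM mulf_eq0; apply/orP; right.
  rewrite rmorph_prod; apply/prodf_eq0; exists i => //.
  rewrite rmorph_prod; apply/prodf_eq0; exists j => //.
  by apply/eqP; apply: (secE _ _ _ _ lt_ij b'B).2.
(* The constant is absorbed into the form of the first pair of points. *)
pose j1 : 'I_d.+1 := Ordinal (d_gt0 : (1 < d.+1)%N).
pose a (i j : 'I_d.+1) := if (i == ord0) && (j == j1) then c else 1.
exists (fun i j => a i j *: secant_form (p i) (p j)); split.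
  move=> i j lt_ij; split; first by rewrite dhomogZ // secant_form_homog.
  have a0 : a i j != 0 by rewrite /a; case: ifP; rewrite ?oner_eq0.
  have aE b : ((a i j *: secant_form (p i) (p j)).@[b] = 0 <->
      (secant_form (p i) (p j)).@[b] = 0).
    rewrite mevalZ; split=> [/eqP|->]; last by rewrite mulr0.
    by rewrite mulf_eq0 (negPf a0) => /eqP.
  move=> B; have [b bB] := coords_of_exists B.
  split=> [/(_ b bB)/aE /(secE _ _ _ _ lt_ij bB)//|Bij b' b'B].
  by apply/aE; apply: (secE _ _ _ _ lt_ij b'B).2.
rewrite /F FE; under [RHS]eq_bigr do under eq_bigr do rewrite -mul_mpolyC.
under [RHS]eq_bigr do rewrite big_split /=.
rewrite big_split /=; congr (_ * _).
rewrite (bigD1 ord0) //= (bigD1 j1) //= {1}/a !eqxx /=.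
rewrite !big1 ?mulr1 // => i.
  by move=> i_neq0; apply: big1 => j _; rewrite /a (negPf i_neq0).
by case/andP => _ i_neq1; rewrite /a (negPf i_neq1).
Qed.
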